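(* Let $(\mathscr{H},\mathscr{C})$ be a continuous field of Hilbert spaces over a topological space $X$. Let $(\zeta_\alpha)_{\alpha\in A}$ be a net in $\mathscr{H}$ that is eventually bounded (i.e. $\sup_{\alpha\ge\alpha_0}\|\zeta_\alpha\|<\infty$ for some $\alpha_0\in A$) and such that $\{\pi(\zeta_\alpha):\alpha\in A\}$ is relatively compact in $X$. Then there exists a meta weakly convergent subnet of $(\zeta_\alpha)_{\alpha\in A}$.
   Context: A section of a family $\mathscr{H}=(\mathscr{H}_x)_{x\in X}$ of Hilbert spaces is a map $f$ on $X$ with $f(x)\in\mathscr{H}_x$; $\Gamma(\mathscr{H})$ is the vector space of sections; $\mathscr{H}$ is also identified with $\bigsqcup_x\mathscr{H}_x$ with projection $\pi:\mathscr{H}\to X$. $(\mathscr{H},\mathscr{C})$ is a continuous field of Hilbert spaces if $\mathscr{C}\subset\Gamma(\mathscr{H})$ is a linear subspace such that: (a) $x\mapsto\|f(x)\|$ is continuous for all $f\in\mathscr{C}$; (b) every $g\in\Gamma(\mathscr{H})$ such that for all $x\in X,\varepsilon>0$ there are $f\in\mathscr{C}$ and a neighborhood $U$ of $x$ with $\|g(y)-f(y)\|\le\varepsilon$ for all $y\in U$ belongs to $\mathscr{C}$; (c) for all $x\in X,\zeta\in\mathscr{H}_x$ there is $f\in\mathscr{C}$ with $f(x)=\zeta$. Strong topology on $\mathscr{H}$: base $\{\zeta\in\mathscr{H}:\pi(\zeta)\in V,\ \|\zeta-f(\pi(\zeta))\|<\varepsilon\}$, $V\subset X$ open, $f\in\mathscr{C}$,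 $\varepsilon>0$; convergence is written $\xrightarrow{\mathsf{s}}$. A net $(\zeta_\alpha)_{\alpha\in A}$ in $\mathscr{H}$ converges meta weakly to $\zeta_\infty\in\mathscr{H}$ if $\pi(\zeta_\alpha)\to\pi(\zeta_\infty)$ and for every net $(\eta_\alpha)_{\alpha\in A}$ in $\mathscr{H}$ with $\pi(\eta_\alpha)=\pi(\zeta_\alpha)$ for all $\alpha\in A$ and every $\eta_\infty\in\mathscr{H}_{\pi(\zeta_\infty)}$: $\eta_\alpha\xrightarrow{\mathsf{s}}\eta_\infty$ implies $\langle\zeta_\alpha,\eta_\alpha\rangle\to\langle\zeta_\infty,\eta_\infty\rangle$. A subnet of $(\zeta_\alpha)_{\alpha\in A}$ is a net $(\zeta_{\varphi(\beta)})_{\beta\in B}$ with $\varphi:B\to A$ order preserving and with cofinal image (for every $\alpha\in A$ there is $\beta\in B$ with $\varphi(\beta)\ge\alpha$). *)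

(* Defs.v *)
(* Built on MathComp-Analysis.  Hilbert spaces are complex; as usual for normed
   modules over R[i], norms are elements of R[i] (real and nonnegative). *)
From HB Require Import structures.
From mathcomp Require Import all_boot all_order all_algebra.
From mathcomp Require Import all_classical all_reals all_analysis.
From mathcomp Require Import sesquilinear complex.

Set Implicit Arguments.
Unset Strict Implicit.
Unset Printing Implicit Defensive.

Import Order.TTheory GRing.Theory Num.Theory.
Import numFieldNormedType.Exports.

Local Open Scope classical_set_scope.
Local Open Scope ring_scope.

(* The inner product is linear in its first argument. *)
HB.mixin Record CompleteNormedModule_isHilbert (R : realType) (T : Type)
    & CompleteNormedModule R[i] T := {
  hinner : {dot T for (@conjc R)};
  norm_hinnerE : forall x : T, `|x| ^+ 2 = hinner x x
}.

#[short(type="hilbertType")]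
HB.structure Definition Hilbert (R : realType) :=
  {T of CompleteNormedModule R[i] T & CompleteNormedModule_isHilbert R T}.

Record directedSet := DirectedSet {
  dirset :> Type;
  dirle : dirset -> dirset -> Prop;
  dirle_refl : forall a, dirle a a;
  dirle_trans : forall a b c, dirle a b -> dirle b c -> dirle a c;
  dir_inhabited : inhabited dirset;
  dir_upper : forall a b, exists c, dirle a c /\ dirle b c
}.

(* The filter of eventual subsets of A: a net u : A -> T converges to l
   exactly when u @ tails A --> l. *)
Definition tails (A : directedSet) : set_system A :=
  [set S | exists a0 : A, forall a : A, dirle a0 a -> S a].
Arguments tails A : clear implicits.

Global Instance tails_proper (A : directedSet) : ProperFilter (tails A).
Proof.
split.
  by move=> [a0 h]; exact: (h a0 (dirle_refl a0)).
split.
- by case: (dir_inhabited A) => a0; exists a0.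
- move=> P Q [a ha] [b hb]; have [c [ac bc]] := dir_upper a b.
  exists c => d cd; split.
    exact: ha (dirle_trans ac cd).
  exact: hb (dirle_trans bc cd).
- by move=> P Q PQ [a ha]; exists a => b ab; exact/PQ/ha.
Qed.

(* (zeta (phi b))_(b : B) is a subnet of (zeta a)_(a : A). *)
Definition subnet_map (A B : directedSet) (phi : B -> A) : Prop :=
  (forall b b', dirle b b' -> dirle (phi b) (phi b')) /\
  (forall a, exists b, dirle a (phi b)).

Record continuousField (R : realType) (X : topologicalType) := ContinuousField {
  fiber :> X -> hilbertType R;
  csections : set (forall x, fiber x);
  csections0 : csections (fun=> 0);
  csectionsD : forall f g, csections f -> csections g ->
    csections (fun x => f x + g x);
  csectionsZ : forall (c : R[i]) f, csections f ->
    csections (fun x => c *: f x);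
  csections_norm : forall f, csections f ->
    continuous (fun x => `|f x| : R[i]^o);
  csections_local : forall g : (forall x, fiber x),
    (forall (x : X) (e : R[i]), 0 < e -> exists2 f, csections f &
      \forall y \near x, `|g y - f y| <= e) ->
    csections g;
  csections_fill : forall (x : X) (z : fiber x),
    exists2 f, csections f & f x = z
}.

(* The disjoint union of the fibers, as an alias so as not to inherit the
   coproduct topology that the library puts on sigma types. *)
Definition totalSpace (R : realType) (X : topologicalType)
    (H : continuousField R X) : Type := {x : X & H x}.

Section Total.
Context {R : realType} {X : topologicalType} {H : continuousField R X}.

Definition tpoint (x : X) (z : H x) : totalSpace H := existT _ x z.
Definition tbase (z : totalSpace H) : X := projT1 z.
Definition tvect (z : totalSpace H) : H (tbase z) := projT2 z.

(* Basic open sets of the strong topology. *)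
Definition tube (V : set X) (f : forall x, H x) (e : R[i]) : set (totalSpace H) :=
  [set z | V (tbase z) /\ `|tvect z - f (tbase z)| < e].

End Total.

Section StrongTopology.
Context {R : realType} {X : topologicalType} (H : continuousField R X).

HB.instance Definition _ := gen_eqMixin (totalSpace H).
HB.instance Definition _ := gen_choiceMixin (totalSpace H).

Let idx : Type := (set X * (forall x, H x) * R[i])%type.
HB.instance Definition _ := gen_eqMixin idx.
HB.instance Definition _ := gen_choiceMixin idx.
HB.instance Definition _ := isPointed.Build idx (setT, (fun=> 0), 0).

Let D : set idx := [set p | [/\ open p.1.1, csections p.1.2 & 0 < p.2]].
Let b (p : idx) : set (totalSpace H) := tube p.1.1 p.1.2 p.2.

Let b_cover : \bigcup_(p in D) b p = setT.
Proof.
rewrite -subTset => t _; have [f Cf ft] := csections_fill (tvect t).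
exists (setT, f, 1); first by split; [exact: openT| |exact: ltr01].
by split => //=; rewrite ft subrr normr0.
Qed.

Let sections_distC (f g : forall x, H x) : csections f -> csections g ->
  continuous (fun x => `|f x - g x| : R[i]^o).
Proof.
move=> Cf Cg; have /csections_norm := csectionsD Cf (csectionsZ (-1) Cg).
by under eq_fun do rewrite scaleN1r.
Qed.

Let tube_near (t : totalSpace H) (f g : forall x, H x) (e : R[i]) :
    csections f -> csections g -> f (tbase t) = tvect t ->
    `|tvect t - g (tbase t)| < e ->
  exists2 d : R[i], 0 < d & \forall y \near tbase t,
    `|f y - g y| + d <= e.
Proof.
move=> Cf Cg ft te; rewrite -ft in te.
set n := `|f (tbase t) - g (tbase t)| in te.
have d0 : 0 < (e - n) / 2 by rewrite divr_gt0// subr_gt0.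
exists ((e - n) / 2) => //.
have := sections_distC Cf Cg (x := tbase t).
move=> /cvgrPdist_lt /(_ _ d0); apply: filterS => y /=.
rewrite distrC real_ltr_distl ?realB ?normr_real ?gtr0_real//.
move=> /andP[_ /ltW]; rewrite -(lerD2r ((e - n) / 2)) => /le_trans; apply.
by rewrite -addrA -splitr addrC subrK.
Qed.

Let b_join (i j : idx) t : D i -> D j -> b i t -> b j t ->
  exists k, [/\ D k, b k t & b k `<=` b i `&` b j].
Proof.
case: i => [[V1 f1] e1]; case: j => [[V2 f2] e2].
move=> [/= oV1 Cf1 e10] [/= oV2 Cf2 e20] [/= V1t t1] [/= V2t t2].
have [f Cf ft] := csections_fill (tvect t).
have [d1 d10 n1] := tube_near Cf Cf1 ft t1.
have [d2 d20 n2] := tube_near Cf Cf2 ft t2.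
have [d [d0 dd1 dd2]] : exists d : R[i], [/\ 0 < d, d <= d1 & d <= d2].
  have [d12|/ltW d21] := real_leP (gtr0_real d10) (gtr0_real d20).
    by exists d1.
  by exists d2.
pose W := V1 `&` V2 `&` interior [set y | `|f y - f1 y| + d1 <= e1 /\
                                        `|f y - f2 y| + d2 <= e2].
exists (W, f, d); split.
- by split => //=; apply: openI; [exact: openI|exact: open_interior].
- split => /=; last by rewrite ft subrr normr0.
  by split=> //; apply: filterS2 n1 n2.
- move=> s [/= [[V1s V2s] /interior_subset[/= s1 s2]] sd]; split; split => //=.
  + apply: lt_le_trans s1; rewrite [ltRHS]addrC -(subrKA (f (tbase s))).
    by apply: le_lt_trans (ler_normD _ _) _; rewrite ltrD2r (lt_le_trans sd).
  + apply: lt_le_trans s2; rewrite [ltRHS]addrC -(subrKA (f (tbase s))).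
    by apply: le_lt_trans (ler_normD _ _) _; rewrite ltrD2r (lt_le_trans sd).
Qed.

HB.instance Definition _ :=
  isBaseTopological.Build (totalSpace H) b_cover b_join.

End StrongTopology.

(* A net over the same base points as zeta is a dependent family eta, the a-th
   element of the net being tpoint (eta a). *)
Definition meta_weak_cvg (R : realType) (X : topologicalType)
    (H : continuousField R X) (A : directedSet)
    (zeta : A -> totalSpace H) (zetaoo : totalSpace H) : Prop :=
  (tbase (zeta a) @[a --> tails A] --> tbase zetaoo) /\
  forall (eta : forall a, H (tbase (zeta a))) (etaoo : H (tbase zetaoo)),
    tpoint (eta a) @[a --> tails A] --> tpoint etaoo ->
    (hinner (tvect (zeta a)) (eta a) : R[i]^o) @[a --> tails A] -->
      (hinner (tvect zetaoo) etaoo : R[i]^o).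

(* Main.v *)
(* Choose an ultrafilter U finer than the tails of A.  By relative compactness
   the base points converge along U to some x, and boundedness together with
   the continuity of norms of sections makes
     rho(f(x)) = lim_U Re <zeta_a, f(pi(zeta_a))>   (f a continuous section)
   a well-defined bounded real-linear functional on the fiber over x; its Riesz
   representative is the weak limit.  A strongly convergent eta_a is
   asymptotically a section f through its limit, so only sections matter.
   Working with real parts suffices, as Im <z, y> = Re <z, i y>. *)
Require Import Defs.
From HB Require Import structures.
From mathcomp Require Import all_boot all_order all_algebra.
From mathcomp Require Import all_classical all_reals all_analysis.
From mathcomp Require Import sesquilinear complex ring lra.

Set Implicit Arguments.
Unset Strict Implicit.
Unset Printing Implicit Defensive.

Import Order.TTheory GRing.Theory Num.Theory.
Import numFieldNormedType.Exports.

Local Open Scope classical_set_scope.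
Local Open Scope ring_scope.

(** * Real parts of inner products, and Riesz representation *)

Section RealPart.
Context {R : realType} {T : hilbertType R}.
Implicit Types (x y z : T) (r : R).

(** Values in [R] instead of [R[i]] give access to infima and to compact intervals. *)
Definition rinner x y : R := complex.Re (hinner x y).
Definition rnorm x : R := complex.Re `|x|.

Lemma rnormE x : `|x| = (rnorm x)%:C%C.
Proof. by rewrite /rnorm RRe_real// normr_real. Qed.

Lemma rnorm_ge0 x : 0 <= rnorm x.
Proof. by rewrite -ler0c -rnormE. Qed.

Lemma rinnerxx x : rinner x x = rnorm x ^+ 2.
Proof. by rewrite /rinner -norm_hinnerE rnormE -rmorphXn. Qed.

Lemma rinnerDl x y z : rinner (x + y) z = rinner x z + rinner y z.
Proof. by rewrite /rinner linearDl raddfD. Qed.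

Lemma rinnerC x y : rinner x y = rinner y x.
Proof.
have Re_conj (c : R[i]) : complex.Re (conjc c) = complex.Re c by case: c.
by rewrite /rinner hermC expr0 mul1r; exact: Re_conj.
Qed.

Lemma rinnerZl r x y : rinner (r%:C%C *: x) y = r * rinner x y.
Proof.
rewrite /rinner linearZl_LR/=; case: (hinner x y) => a b /=.
by rewrite mul0r subr0.
Qed.

Lemma rinnerDr x y z : rinner z (x + y) = rinner z x + rinner z y.
Proof. by rewrite rinnerC rinnerDl !(rinnerC z). Qed.

Lemma rinnerZr r x y : rinner y (r%:C%C *: x) = r * rinner y x.
Proof. by rewrite rinnerC rinnerZl (rinnerC y). Qed.

Lemma Im_hinner x y : complex.Im (hinner x y) = rinner x ('i%C *: y).
Proof.
rewrite /rinner linearZr_LR/=; case: (hinner x y) => a b /=.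
by rewrite mul0r mulN1r opprK add0r.
Qed.

Lemma rnormi x : rnorm ('i%C *: x) = rnorm x.
Proof.
apply: (@complexI R); rewrite -!rnormE normrZ normc_def/=.
by rewrite expr0n/= add0r expr1n sqrtr1 mul1r.
Qed.

Lemma rinner0l y : rinner 0 y = 0.
Proof. by rewrite /rinner linear0l. Qed.

(** Cauchy-Schwarz: the squared norm of [s x + t y] is nonnegative at [s = rnorm y], [t = rnorm x]
    and at [t = - rnorm x]. Zero vectors come first because the factor [rnorm x * rnorm y] is then
    cancelled. *)
Lemma rinner_le x y : `|rinner x y| <= rnorm x * rnorm y.
Proof.
have [->|x0] := eqVneq x 0.
  by rewrite rinner0l normr0 mulr_ge0 ?rnorm_ge0.
have [->|y0] := eqVneq y 0.
  by rewrite rinnerC rinner0l normr0 mulr_ge0 ?rnorm_ge0.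
have rnorm_gt0 z : z != 0 -> 0 < rnorm z by rewrite -ltcR -rnormE normr_gt0.
have quadratic_ge0 (s t : R) : 0 <= s ^+ 2 * rnorm x ^+ 2 +
    t ^+ 2 * rnorm y ^+ 2 + 2 * s * t * rinner x y.
  have := sqr_ge0 (rnorm (s%:C%C *: x + t%:C%C *: y)).
  rewrite -[X in _ <= X -> _]rinnerxx !(rinnerDl, rinnerDr).
  by rewrite !(rinnerZl, rinnerZr) !rinnerxx (rinnerC y) => h; lra.
have xy0 : 0 < rnorm x * rnorm y by rewrite mulr_gt0 ?rnorm_gt0.
have h1 := quadratic_ge0 (rnorm y) (rnorm x).
have h2 := quadratic_ge0 (rnorm y) (- rnorm x).
by rewrite ler_norml; apply/andP; split; nra.
Qed.
End RealPart.

(* [z] minimizes the functional [y |-> |y|^2 - 2 rho y]; the parallelogram law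
   makes the filter of its almost minimizers Cauchy. *)
Lemma riesz_representation (R : realType) (T : hilbertType R) (rho : T -> R)
    (M : R) :
  {morph rho : x y / x + y} ->
  (forall r x, rho (r%:C%C *: x) = r * rho x) ->
  (forall x, `|rho x| <= M * rnorm x) ->
  exists z, forall y, rinner z y = rho y.
Proof.
move=> rhoD rhoZ rho_le.
pose J y := rnorm y ^+ 2 - 2 * rho y.
have J_lb y : - M ^+ 2 <= J y.
  have := rho_le y; rewrite ler_norml => /andP[_ h].
  by have := sqr_ge0 (M - rnorm y); rewrite /J; nra.
pose m := inf (range J).
have infJ : has_inf (range J).
  by split; [exists (J 0), 0|exists (- M ^+ 2) => _ [y _ <-]].
have m_le y : m <= J y by apply: ge_inf; [case: infJ|exists y].
have m_adh e : 0 < e -> exists y, J y < m + e.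
  by move=> e0; have [_ [y _ <-] ?] := inf_adherent e0 infJ; exists y.
pose F : set_system T :=
  [set S | exists2 e, 0 < e & [set y | J y < m + e] `<=` S].
have FF : ProperFilter F.
  split; first by case=> e /m_adh[y Jy]; apply; exact: Jy.
  split.
  - by exists 1.
  - move=> P Q [d d0 dP] [e e0 eQ]; exists (Num.min d e).
      by rewrite lt_min d0.
    move=> y /= Jy; split; [apply: dP|apply: eQ] => /=.
      by rewrite (lt_le_trans Jy)// lerD2l ge_min lexx.
    by rewrite (lt_le_trans Jy)// lerD2l ge_min lexx orbT.
  - by move=> P Q PQ [e e0 eP]; exists e => // y /eP /PQ.
(* The left side is [2 * J x + 2 * J y] minus four times [J] at the midpoint, where [J] is at least
   [m]. *)
have dist_le x y : rnorm (x - y) ^+ 2 <= 2 * (J x - m) + 2 * (J y - m).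
  have := m_le (2^-1%:C%C *: (x + y)).
  rewrite -scaleN1r -(rmorphN1 (@real_complex R)) /J rhoZ rhoD -!rinnerxx.
  rewrite !(rinnerDl, rinnerDr, rinnerZl, rinnerZr) (rinnerC y x).
  by move=> h; lra.
have : cauchy F.
  apply: cauchy_exP => e e0.
  have er : e = (complex.Re e)%:C%C by rewrite RRe_real// gtr0_real.
  have {}e0 : 0 < complex.Re e by rewrite -ltcR -er.
  set r := complex.Re e in er e0.
  (* By [dist_le], two points with [J] below [m + r ^+ 2 / 8] have squared distance below
     [r ^+ 2 / 2]. *)
  have d0 : 0 < r ^+ 2 / 8 by nra.
  have [y Jy] := m_adh _ d0; exists y, (r ^+ 2 / 8) => // x /= Jx.
  rewrite -ball_normE/= er rnormE ltcR -(@ltr_pXn2r _ 2)//;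
    rewrite ?nnegrE ?rnorm_ge0 ?ltW//.
  by apply: le_lt_trans (dist_le y x) _; nra.
move=> /cauchy_cvgP/cvg_ex[z Fz]; exists z => y.
(* Almost minimizers [w] near [z] stand in for [z], which avoids proving [J] continuous. *)
have near_z e : 0 < e -> exists w, rnorm (z - w) < e /\ J w < m + e.
  move=> e0; have e0' : 0 < e%:C%C by rewrite ltcR.
  have Jz : F [set w | J w < m + e] by exists e.
  have [w [zw Jw]] := filter_ex (filterI (Fz _ (nbhsx_ballx z _ e0')) Jz).
  exists w; split=> //.
  by move: zw; rewrite -ball_normE/= rnormE ltcR.
(* The right side is the change of [J] from [z] to [z + t y]. *)
have variation t : 0 <= t ^+ 2 * rnorm y ^+ 2 + 2 * t * (rinner z y - rho y).
  apply/ler_addgt0Pl => e e0.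
  (* Almost minimality of [w] costs [e / K], and replacing [z] by [w] costs [2 * |t| * rnorm y]
     times [e / K]; together this is [e]. *)
  pose K := 1 + 2 * `|t| * rnorm y.
  have K0 : 0 < K.
    by rewrite ltr_pwDl// !mulr_ge0 ?rnorm_ge0.
  have [w [zw Jw]] := near_z (e / K) (divr_gt0 e0 K0).
  have := m_le (w + t%:C%C *: y).
  rewrite /J rhoD rhoZ -rinnerxx !(rinnerDl, rinnerDr).
  rewrite !(rinnerZl, rinnerZr) !rinnerxx (rinnerC y w).
  have : `|2 * t * rinner (z - w) y| <= 2 * `|t| * rnorm y * (e / K).
    rewrite 2!normrM -!mulrA (ger0_norm (ler0n _ _)) !ler_wpM2l//.
    rewrite (le_trans (rinner_le _ _))// mulrC ler_wpM2l ?rnorm_ge0//.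
    exact: ltW.
  have -> : 2 * `|t| * rnorm y * (e / K) = e - e / K.
    by rewrite /K; field; rewrite gt_eqF.
  rewrite rinnerDl -scaleN1r -(rmorphN1 (@real_complex R)) rinnerZl ler_norml.
  move=> /andP[h1 h2]; move: Jw; rewrite /J => h3 h4.
  by lra.
set c := rinner z y - rho y in variation.
apply/eqP; rewrite -subr_eq0 -/c; apply/negP => /negP c0.
have n1 : 0 < rnorm y ^+ 2 + 1 by rewrite ltr_wpDl ?sqr_ge0.
(* The minimizing [t] would be [- c / rnorm y ^+ 2]; the added 1 keeps the denominator positive, and
   the value is still negative when [c] is nonzero. *)
have := variation (- c / (rnorm y ^+ 2 + 1)).
set n := rnorm y ^+ 2 in n1 *.
have -> : (- c / (n + 1)) ^+ 2 * n + 2 * (- c / (n + 1)) * c =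
    - (c / (n + 1)) ^+ 2 * (n + 2).
  by field; rewrite gt_eqF.
rewrite mulNr oppr_ge0 leNgt mulr_gt0//; last by lra.
by rewrite exprn_even_gt0//= mulf_neq0// invr_eq0 gt_eqF.
Qed.

(** * Limits along ultrafilters, and subnets *)

Lemma fmap_ultra (I J : Type) (g : I -> J) (F : set_system I) :
  UltraFilter F -> UltraFilter (g @ F).
Proof.
move=> FU; split; first exact: fmap_proper_filter.
move=> G GF FG; apply/seteqP; split=> [S GS|]; last exact: FG.
have [//|FSC] := in_ultra_setVsetC (g @^-1` S) FU.
by have [j []] := filter_ex (filterI GS (FG (~` S) FSC)).
Qed.

Lemma bounded_ultra_cvg (R : realType) (I : Type) (F : set_system I)
    (g : I -> R) (K : R) : UltraFilter F -> (\forall i \near F, `|g i| <= K) ->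
  exists2 l, g i @[i --> F] --> l & `|l| <= K.
Proof.
move=> FU gK; have := @segment_compact R (- K) K; rewrite compact_ultra.
move=> /(_ _ (fmap_ultra g FU)) []; last first.
  move=> l [/= lK Fl]; exists l => //.
  by move: lK; rewrite in_itv/= ler_norml.
by apply: filterS gK => i; rewrite /= in_itv/= ler_norml.
Qed.

Lemma cvg_Re_Im (R : realType) (I : Type) (F : set_system I) (u : I -> R[i])
    (l : R[i]) : Filter F ->
  complex.Re (u i) @[i --> F] --> complex.Re l ->
  complex.Im (u i) @[i --> F] --> complex.Im l ->
  (u i : R[i]^o) @[i --> F] --> (l : R[i]^o).
Proof.
move=> FF /cvgrPdist_lt uRe /cvgrPdist_lt uIm; apply/cvgrPdist_lt => e e0.
have [r er] : exists r, e = r%:C%C by apply/complex_realP/gtr0_real.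
move: e0; rewrite {}er ltcR => r0.
have r20 : 0 < r / 2 by rewrite divr_gt0.
apply: filterS2 (uRe _ r20) (uIm _ r20) => i /=.
rewrite -!raddfB; set d := l - u i => dRe dIm.
rewrite -/d [d]complexE (splitr r) rmorphD.
rewrite (le_lt_trans (ler_normD _ _))// ltrD//.
  by rewrite normc_def/= expr0n/= addr0 sqrtr_sqr ltcR; exact: dRe.
by rewrite normrM !normc_def/= expr0n/= expr1n add0r sqrtr1 mul1r addr0
  sqrtr_sqr ltcR; exact: dIm.
Qed.

(* The subnet consists of pointed members of [U], which makes every member of
   [U] eventual along it while keeping [phi] order preserving. *)
Lemma filter_subnet (A : directedSet) (U : set_system A) :
  ProperFilter U -> tails A `<=` U ->
  exists (B : directedSet) (phi : B -> A),
    subnet_map phi /\ phi b @[b --> tails B] --> U.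
Proof.
move=> UF AU.
pose T := {p : A * set A | U p.2 /\ p.2 p.1}.
pose le (p q : T) := dirle (sval p).1 (sval q).1 /\ (sval q).2 `<=` (sval p).2.
(* Tails belong to [U], so every member of [U] has points arbitrarily far out; this gives both
   directedness and cofinality. *)
have point S : U S -> forall a0,
    exists p : T, dirle a0 (sval p).1 /\ (sval p).2 = S.
  move=> US a0; have Ua0 : U [set a | dirle a0 a] by apply: AU; exists a0.
  have [a [Sa aa0]] := filter_ex (filterI US Ua0).
  by exists (exist _ (a, S) (conj US Sa)).
have le_refl p : le p p by split=> //; exact: dirle_refl.
have le_trans' p q r : le p q -> le q r -> le p r.
  move=> [pq qp] [qr rq]; split; first exact: dirle_trans pq qr.
  exact: subset_trans rq qp.
have inh : inhabited T.
  have [a0] := dir_inhabited A; have [p _] := point _ filterT a0.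
  exact: inhabits p.
have upper p q : exists r, le p r /\ le q r.
  have [a0 [pa qa]] := dir_upper (sval p).1 (sval q).1.
  have [[Up _] [Uq _]] := (svalP p, svalP q).
  have [r [ar rE]] := point _ (filterI Up Uq) a0.
  exists r; rewrite /le rE; split; (split; first exact: dirle_trans ar).
    exact: subIsetl.
  exact: subIsetr.
exists (DirectedSet le_refl le_trans' inh upper), (fun p => (sval p).1).
split; first split.
- by move=> p q [].
- by move=> a; have [p [ap _]] := point _ filterT a; exists p.
(* Beyond an index with set [S], sets are contained in [S], and each contains its own point. *)
- move=> S US; have [a0] := dir_inhabited A.
  have [p [_ pS]] := point _ US a0; exists p => q [_]; rewrite pS; apply.
  exact: (svalP q).2.
Qed.

(** * Continuous sections and strong convergence *)

Section ContinuousField.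
Context {R : realType} {X : topologicalType} {H : continuousField R X}.

Lemma csectionsB (f g : forall x, H x) : csections f -> csections g ->
  csections (fun x => f x - g x).
Proof.
move=> Cf Cg; have := csectionsD Cf (csectionsZ (-1) Cg).
by congr csections; apply: functional_extensionality_dep => x; rewrite scaleN1r.
Qed.

Lemma csections_rnorm (f : forall x, H x) : csections f ->
  continuous (fun x => rnorm (f x)).
Proof.
move=> Cf x; apply/cvgrPdist_lt => e e0.
have /cvgrPdist_lt/(_ e%:C%C) := csections_norm Cf (x := x).
rewrite ltcR => /(_ e0); apply: filterS => y /=.
by rewrite !rnormE -rmorphB normc_def/= expr0n/= addr0 sqrtr_sqr ltcR.
Qed.

Lemma tube_open (V : set X) (f : forall x, H x) (e : R[i]) :
  open V -> csections f -> 0 < e -> open (tube V f e : set (totalSpace H)).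
Proof.
move=> oV Cf e0; exists [set (V, f, e)]; last by rewrite bigcup_set1.
by move=> _ ->.
Qed.

(** The tube of radius [e] around [f] over all of [X] is a strong neighborhood of the limit. *)
Lemma strong_cvg_rnorm (I : Type) (F : set_system I) (p : I -> X)
    (eta : forall i, H (p i)) (x : X) (f : forall x, H x) (e : R) : Filter F ->
  csections f -> tpoint (eta i) @[i --> F] --> tpoint (f x) -> 0 < e ->
  \forall i \near F, rnorm (eta i - f (p i)) < e.
Proof.
move=> FF Cf etaf e0.
have : nbhs (tpoint (f x)) (tube setT f e%:C%C).
  apply: open_nbhs_nbhs; split.
    by apply: tube_open => //; [exact: openT|rewrite ltcR].
  by split=> //=; rewrite subrr normr0 ltcR.
move=> /etaf eta_near.
have : \forall i \near F, tube setT f e%:C%C (tpoint (eta i)).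
  exact: eta_near.
by apply: filterS => i [_] /=; rewrite rnormE ltcR.
Qed.

End ContinuousField.

(** * The weak limit, and its pairing with strongly convergent nets *)

Section WeakLimit.
Context {R : realType} {X : topologicalType} {H : continuousField R X}.
Context {I : Type} (U : set_system I) (zeta : I -> totalSpace H).
Context (x0 : X) (M : R).
Context (UU : UltraFilter U).
Context (zeta_base : tbase (zeta i) @[i --> U] --> x0).
Context (M_gt0 : 0 < M).
Context (zeta_le : \forall i \near U, rnorm (tvect (zeta i)) <= M).

Let pairing (f : forall x, H x) (i : I) : R :=
  rinner (tvect (zeta i)) (f (tbase (zeta i))).

(** Continuity of the norm of [f] bounds the pairing near [x0] with slack [e]. Limits being unique,
    the same [l] serves for every [e], and the slack disappears. *)
Let pairing_cvg f : csections f ->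
  exists2 l, pairing f i @[i --> U] --> l & `|l| <= M * rnorm (f x0).
Proof.
move=> Cf.
have bound e : 0 < e -> exists2 l, pairing f i @[i --> U] --> l &
    `|l| <= M * (rnorm (f x0) + e).
  move=> e0; apply: bounded_ultra_cvg.
  have /cvgrPdist_lt/(_ e e0) f_near :=
    cvg_comp _ _ zeta_base (csections_rnorm Cf (x := x0)).
  apply: filterS2 zeta_le f_near => i zi fi.
  rewrite (le_trans (rinner_le _ _))// ler_pM ?rnorm_ge0//.
  by move: fi; rewrite /= ltr_distlC => /andP[_ /ltW].
have [l fl _] := bound 1 ltr01; exists l => //.
apply/ler_addgt0Pl => e e0.
have [k fk] := bound (e / M) (divr_gt0 e0 M_gt0).
rewrite (cvg_unique (@Rhausdorff R) fk fl) => /le_trans; apply.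
by rewrite mulrDr mulrCA divff ?gt_eqF// mulr1 addrC.
Qed.

Lemma weak_limit_exists : exists z : H x0, forall f, csections f ->
  rinner (tvect (zeta i)) (f (tbase (zeta i))) @[i --> U] --> rinner z (f x0).
Proof.
have [s sP] : {s : forall (y : H x0) x, H x &
    forall y, csections (s y) /\ s y x0 = y}.
  apply: (@choice _ _ (fun y f => csections f /\ f x0 = y)) => y.
  by have [f Cf fy] := csections_fill y; exists f.
have [rho rhoP] : {rho : H x0 -> R &
    forall y, pairing (s y) i @[i --> U] --> rho y}.
  apply: (@choice _ _ (fun y l => pairing (s y) i @[i --> U] --> l)) => y.
  by have [l ? _] := pairing_cvg (sP y).1; exists l.
(* The choice of section is immaterial: [f - s (f x0)] vanishes at [x0], so its pairing tends to 0
   by the bound in [pairing_cvg]. *)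
have rho_cvg f : csections f -> pairing f i @[i --> U] --> rho (f x0).
  move=> Cf; have [Cs sf] := sP (f x0).
  have [l fl] := pairing_cvg (csectionsB Cf Cs).
  rewrite sf subrr [rnorm 0]/rnorm normr0 mulr0 normr_le0 => /eqP l0.
  have := cvgD fl (rhoP (f x0)); rewrite l0 add0r => fs.
  rewrite (_ : pairing f = fun i => pairing (fun x => f x - s (f x0) x) i +
    pairing (s (f x0)) i)//; first exact: fs.
  by apply/funext => i; rewrite /pairing -rinnerDr subrK.
(* [s] itself need not be linear, but by [rho_cvg] sums and multiples of chosen sections compute
   [rho] as well. *)
have [|||z zP] := @riesz_representation R (H x0) rho M.
- move=> y y'; have [Cs sy] := sP y; have [Cs' sy'] := sP y'.
  have := rho_cvg _ (csectionsD Cs Cs'); rewrite sy sy'.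
  rewrite (_ : pairing _ = fun i => pairing (s y) i + pairing (s y') i).
    move=> ss; apply: (cvg_unique (@Rhausdorff R) ss).
    exact: cvgD (rhoP y) (rhoP y').
  by apply/funext => i; rewrite /pairing -rinnerDr.
- move=> r y; have [Cs sy] := sP y.
  have := rho_cvg _ (csectionsZ r%:C%C Cs); rewrite sy.
  rewrite (_ : pairing _ = fun i => r * pairing (s y) i).
    move=> rs; apply: (cvg_unique (@Rhausdorff R) rs).
    exact: cvgM (cvg_cst r) (rhoP y).
  by apply/funext => i; rewrite /pairing -rinnerZr.
- move=> y; have [Cs sy] := sP y; have [l sl] := pairing_cvg Cs.
  by rewrite (cvg_unique (@Rhausdorff R) sl (rhoP y)) sy.
by exists z => f Cf; rewrite zP; exact: rho_cvg.
Qed.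

End WeakLimit.

(** By Cauchy-Schwarz, replacing [f] by [eta] changes the pairing by at most [M] times the norm of
    their difference. *)
Lemma rinner_strong_cvg (R : realType) (X : topologicalType)
    (H : continuousField R X) (I : Type) (F : set_system I)
    (zeta : I -> totalSpace H) (eta : forall i, H (tbase (zeta i)))
    (f : forall x, H x) (l M : R) : Filter F -> 0 < M ->
  (\forall i \near F, rnorm (tvect (zeta i)) <= M) ->
  (forall e, 0 < e ->
    \forall i \near F, rnorm (eta i - f (tbase (zeta i))) < e) ->
  rinner (tvect (zeta i)) (f (tbase (zeta i))) @[i --> F] --> l ->
  rinner (tvect (zeta i)) (eta i) @[i --> F] --> l.
Proof.
move=> FF M0 zM etaf /cvgrPdist_lt fl; apply/cvgrPdist_lt => e e0.
have e20 : 0 < e / 2 by rewrite divr_gt0.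
apply: filterS3 zM (etaf _ (divr_gt0 e20 M0)) (fl _ e20) => i zi ei fi.
set z := tvect _ in zi fi *.
rewrite -(subrK (f (tbase (zeta i))) (eta i)) rinnerDr.
rewrite [_ + rinner z (f _)]addrC opprD addrA (splitr e).
rewrite (le_lt_trans (ler_normB _ _))// ltr_leD//.
rewrite (le_trans (rinner_le _ _))//.
rewrite (le_trans (ler_pM _ _ zi (ltW ei))) ?rnorm_ge0//.
by rewrite mulrC divfK ?gt_eqF.
Qed.

Theorem proposition4p7 (R : realType) (X : topologicalType)
    (H : continuousField R X) (A : directedSet) (zeta : A -> totalSpace H)
    (zeta_bounded : exists (a0 : A) (M : R[i]),
      forall a : A, dirle a0 a -> `|tvect (zeta a)| <= M)
    (zeta_relcompact : compact (closure [set tbase (zeta a) | a in [set: A]])) :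
  exists (B : directedSet) (phi : B -> A),
    subnet_map phi /\
    exists zetaoo : totalSpace H, meta_weak_cvg (zeta \o phi) zetaoo.
Proof.
have [U [UU AU]] := ultraFilterLemma (tails_proper A).
have [M M0 zM] : exists2 M : R, 0 < M & U [set a | rnorm (tvect (zeta a)) <= M].
  have [a0 [M zM]] := zeta_bounded.
  (* The given bound lies in [R[i]]; its real part bounds the norms, and adding 1 allows division by
     the new bound. *)
  exists (`|complex.Re M| + 1); first by rewrite ltr_wpDl.
  apply: AU; exists a0 => a /zM; rewrite rnormE lecE => /andP[_] /= /le_trans.
  by apply; rewrite (le_trans (ler_norm _))// lerDl.
have [x [_ zx]] : exists x, closure [set tbase (zeta a) | a in [set: A]] x /\
    tbase (zeta a) @[a --> U] --> x.
  move: zeta_relcompact; rewrite compact_ultra.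
  case/(_ _ (fmap_ultra (tbase \o zeta) UU)); last by move=> x [? ?]; exists x.
  apply: (@filterS _ U _ setT _ _ filterT) => a _.
  by apply: subset_closure; exists a.
have [z zP] := weak_limit_exists UU zx M0 zM.
(* The tails of [B] map to a filter finer than [U], so all limits along [U] pass to the subnet. *)
have [B [phi [phiP phiU]]] := filter_subnet (@ultra_proper _ _ UU) AU.
exists B, phi; split=> //; exists (tpoint z); split.
  by apply: cvg_trans zx; exact: (cvg_fmap2 phiU).
move=> eta etaoo eta_cvg; have [f Cf fx] := csections_fill etaoo.
have eta_near e : 0 < e -> \forall b \near tails B,
    rnorm (eta b - f (tbase (zeta (phi b)))) < e.
  move=> e0; apply: (strong_cvg_rnorm (x := x) _ Cf _ e0).
  by rewrite [f x]fx.
have zMB : \forall b \near tails B, rnorm (tvect (zeta (phi b))) <= M.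
  exact: phiU _ zM.
have pairing_cvg g : csections g ->
    rinner (tvect (zeta (phi b))) (g (tbase (zeta (phi b))))
      @[b --> tails B] --> rinner z (g x).
  by move=> Cg; apply: cvg_trans (zP g Cg); exact: (cvg_fmap2 phiU).
have Re_cvg : rinner (tvect (zeta (phi b))) (eta b) @[b --> tails B] -->
    rinner z etaoo.
  apply: (rinner_strong_cvg (zeta := zeta \o phi) _ M0 zMB eta_near).
  by rewrite -fx; exact: pairing_cvg.
(* Multiplication by ['i] preserves [rnorm], so ['i * eta] is asymptotic to the section ['i * f]. *)
have Im_cvg : rinner (tvect (zeta (phi b))) ('i%C *: eta b) @[b --> tails B] -->
    rinner z ('i%C *: etaoo).
  apply: (rinner_strong_cvg (zeta := zeta \o phi)
    (eta := fun b => 'i%C *: eta b) (f := fun x => 'i%C *: f x) _ M0 zMB)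
    => [e e0|].
    by apply: filterS (eta_near e e0) => b; rewrite -scalerBr rnormi.
  by rewrite -fx; exact: (pairing_cvg _ (csectionsZ 'i%C Cf)).
apply: cvg_Re_Im; first exact: Re_cvg.
by rewrite Im_hinner; under eq_fun do rewrite Im_hinner; exact: Im_cvg.
Qed.
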